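(* Suppose that $f\in\mathcal P$, $\lambda>0$ and $f(z)=\sum_{n=0}^{\infty}a_nz^n$ with $a_0\in[0,1)$. If $\{\zeta_n(r)\}_{n=0}^{\infty}\in\mathcal F$ satisfies the inequality $$\zeta_0(r)\ge\frac{2}{1+a_0}\Big[\Phi_1(r)+2\lambda(1-a_0)\frac{r^2}{(1-r^2)^2}\Big]=:\phi(a_0,r),$$ where $\Phi_1(r)=\sum_{n=1}^{\infty}\zeta_n(r)$, then the following sharp inequality holds: $$a_0^2\,\zeta_0(r)+\sum_{n=1}^{\infty}|a_n|\zeta_n(r)+\lambda\Big(\frac{S_r(f)}{\pi}\Big)\le\zeta_0(r)\quad\text{for all } r\le R_{\lambda,2},$$ where $R_{\lambda,2}$ is the minimal positive root of the equation $\zeta_0(r)=\phi(a_0,r)$. This result is sharp for the function $\psi_a(z)=a-2(1-a)\frac{z}{1-z}$, $a\in[0,1)$.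
   Context: $\mathbb D=\{z\in\mathbb C:|z|<1\}$. $\mathcal P$ is the class of analytic functions $f$ on $\mathbb D$ with $\operatorname{Re} f(z)<1$ for all $z\in\mathbb D$. $\mathcal F$ is the set of all sequences $\{\zeta_n(r)\}_{n=0}^\infty$ of nonnegative continuous functions on $[0,1)$ such that $\sum_{n=0}^\infty\zeta_n(r)$ converges locally uniformly with respect to $r\in[0,1)$. $S_r(f)$ denotes the area of the image of the subdisk $|z|<r$ under the mapping $f$. *)

(* Defs.v *)
From mathcomp Require Import all_boot all_order all_algebra.
From mathcomp Require Import complex.
From mathcomp Require Import all_classical all_reals all_analysis.

Set Implicit Arguments.
Unset Strict Implicit.
Unset Printing Implicit Defensive.

Import Order.TTheory GRing.Theory Num.Theory numFieldNormedType.Exports.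

Local Open Scope classical_set_scope.
Local Open Scope ring_scope.
Local Open Scope complex_scope.

Definition disk (R : realType) (r : R) : set R[i] := [set z | `|z| < r%:C].

(* On [R[i]] the norm is complex-valued; the topology and the complex
   derivative are those of the normed module [R[i]^o] over [R[i]], so
   [derivable f z 1] is complex differentiability of [f] at [z]. *)
Definition holomorphic_on (R : realType) (D : set R[i]) (f : R[i] -> R[i]) :=
  forall z, D z -> derivable (f : R[i]^o -> R[i]^o) (z : R[i]^o) 1.

Definition classP (R : realType) (f : R[i] -> R[i]) :=
  holomorphic_on (disk 1) f /\ forall z, disk 1 z -> complex.Re (f z) < 1.

Definition has_expansion (R : realType) (f : R[i] -> R[i]) (a : nat -> R[i]) :=
  forall z : R[i], disk 1 z ->
    series (fun n => a n * z ^+ n : R[i]^o) @ \oo --> (f z : R[i]^o).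

Definition classF (R : realType) (zeta : nat -> R -> R) :=
  [/\ forall n (r : R), 0 <= r < 1 -> 0 <= zeta n r,
      forall n, {within `[0, 1[, continuous (zeta n)} &
      exists Z : R -> R, forall x : R, 0 <= x < 1 ->
        exists2 U : set R, nbhs x U &
          {uniform U `&` `[0, 1[,
            (fun N r => \sum_(0 <= n < N) zeta n r) @ \oo --> Z}].

(* Planar Lebesgue measure, with [R[i]] identified with [R * R]. *)
Definition area (R : realType) (A : set R[i]) : \bar R :=
  ((@lebesgue_measure R) \x (@lebesgue_measure R))%E
    [set (complex.Re w, complex.Im w) | w in A].

(* The area of the image as a set (overlaps are counted once). *)
Definition image_area (R : realType) (f : R[i] -> R[i]) (r : R) : \bar R :=
  area (f @` disk r).

Definition Phi1 (R : realType) (zeta : nat -> R -> R) (r : R) : R :=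
  limn (fun N => \sum_(1 <= n < N) zeta n r).

Definition phi (R : realType) (lambda : R) (zeta : nat -> R -> R)
    (a0 r : R) : R :=
  2 / (1 + a0) *
    (Phi1 zeta r + 2 * lambda * (1 - a0) * (r ^+ 2 / (1 - r ^+ 2) ^+ 2)).

Definition minimal_positive_root (R : realType) (lambda : R)
    (zeta : nat -> R -> R) (a0 rho : R) :=
  [/\ 0 < rho < 1, zeta 0%N rho = phi lambda zeta a0 rho &
      forall r : R, 0 < r < 1 -> zeta 0%N r = phi lambda zeta a0 r -> rho <= r].

(* Valued in [\bar R], so that no convergence of the series of nonnegative
   terms and no finiteness of the area is presupposed. *)
Definition bohr_sum (R : realType) (lambda : R) (zeta : nat -> R -> R)
    (a0 : R) (f : R[i] -> R[i]) (a : nat -> R[i]) (r : R) : \bar R :=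
  ((a0 ^+ 2 * zeta 0%N r)%:E
   + \sum_(1 <= n <oo) (complex.Re `|a n| * zeta n r)%:E
   + lambda%:E * (image_area f r * (pi^-1)%:E))%E.

Definition psi (R : realType) (a : R) (z : R[i]) : R[i] :=
  a%:C - 2 * (1 - a)%:C * (z / (1 - z)).

(* Main.v *)
(* Put c = 1 - a0. If Re p >= 0 on the unit circle for a polynomial p, averaging
   Re p times a polynomial q over N-th roots of unity (N large) gives a weighted
   mean of values of q, so a bound on q over the circle bounds a linear form in
   the coefficients of p. Applied to the partial sums of 1 + e - f(s z), with
   e -> 0 and s -> 1, this bounds the functional q |-> 2 c q_0 - sum_(i >= 1) a_i q_i
   by 2 c sup |q|. Taking q = X^n gives |a_n| <= 2 c; taking for q a truncation of
   (1 + z X) / (1 - z X) - (1 + |z|^2) / (1 - |z|^2) gives the Schwarz-Pick bound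
   for the half-plane.
   Hence f maps |z| < r into psi_a0(|z| < r), which is a Euclidean disc of radius
   2 c r / (1 - r^2): as overlaps are counted once, the area bound is mere
   inclusion. So psi_a0 maximizes every term of the Bohr sum, and its Bohr sum
   is a0^2 zeta_0 + (1 - a0^2) phi. *)
Require Import Defs.
From mathcomp Require Import all_boot all_order all_algebra.
From mathcomp Require Import cyclic separable cyclotomic.
From mathcomp Require Import complex.
From mathcomp Require Import all_classical all_reals all_analysis.
From mathcomp Require Import ring lra zify.
Import Order.TTheory GRing.Theory Num.Theory numFieldNormedType.Exports.
Set Implicit Arguments.
Unset Strict Implicit.
Local Open Scope classical_set_scope.
Local Open Scope ring_scope.
Local Open Scope complex_scope.

(** * Averages over roots of unity *)

Lemma prim_root_exists (C : numClosedFieldType) (n : nat) :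
  (0 < n)%N -> exists w : C, n.-primitive_root w.
Proof.
move=> n0; have [rs Drs] := closed_field_poly_normal ('X^n - 1 : {poly C}).
rewrite (monicP _) in Drs; last exact: monicXnsubC.
rewrite scale1r in Drs.
(* In characteristic 0 the polynomial X^n - 1 has n distinct roots, and n distinct n-th roots of
   unity always include a primitive one. *)
have /hasP[w _ pw] : has n.-primitive_root rs.
  apply: (@has_prim_root C n rs) => //.
  - by apply/allP => z zr; rewrite /root_of_unity Drs root_prod_XsubC.
  - rewrite -separable_prod_XsubC -Drs; apply: separable_Xn_sub_1.
    by rewrite pnatr_eq0 -lt0n.
  - by rewrite -ltnS -(size_prod_XsubC rs id) -Drs size_XnsubC.
by exists w.
Qed.

Lemma prim_root_norm (C : numClosedFieldType) (n : nat) (w : C) :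
  n.-primitive_root w -> `|w| = 1.
Proof.
move=> pw; apply/eqP; rewrite -(@pexpr_eq1 _ _ n) ?normr_ge0//; last exact: prim_order_gt0 pw.
by rewrite -normrX (prim_expr_order pw) normr1.
Qed.

Lemma sum_prim_root (C : numClosedFieldType) (n j : nat) (w : C) :
  n.-primitive_root w ->
  \sum_(k < n) (w ^+ k) ^+ j = (n %| j)%:R * n%:R.
Proof.
move=> pw; under eq_bigr do rewrite -exprM mulnC exprM.
case: (boolP (n %| j)%N) => nj.
  rewrite mul1r (_ : w ^+ j = 1); last by apply/eqP; rewrite -(prim_order_dvd pw).
  by under eq_bigr do rewrite expr1n; rewrite sumr_const card_ord.
rewrite mul0r; apply/eqP.
have : (w ^+ j - 1) * \sum_(k < n) (w ^+ j) ^+ k = 0.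
  by rewrite -subrX1 exprAC (prim_expr_order pw) expr1n subrr.
by move/eqP; rewrite mulf_eq0 subr_eq0 -(prim_order_dvd pw) (negbTE nj).
Qed.

(** Discrete Parseval identity: orthogonality of the powers of w kills every off-diagonal term p_i
    q_j, because both sizes are at most n. *)
Lemma sum_horner_prim_root (C : numClosedFieldType) (n : nat) (w : C) (p q : {poly C}) :
  n.-primitive_root w -> (size p <= n)%N -> (size q <= n)%N ->
  \sum_(k < n) p.[w ^+ k] * q.[(w ^+ k)^-1] = n%:R * \sum_(i < n) p`_i * q`_i.
Proof.
move=> pw sp sq; have n0 := prim_order_gt0 pw.
(* At an n-th root of unity the power -j equals the power n - j, which keeps the exponents
   natural. *)
transitivity (\sum_(k < n) \sum_(i < n) \sum_(j < n)
    (p`_i * q`_j) * (w ^+ k) ^+ (i + (n - j))).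
  apply: eq_bigr => k _; rewrite (horner_coef_wide _ sp) (horner_coef_wide _ sq).
  rewrite mulr_suml; apply: eq_bigr => i _; rewrite mulr_sumr; apply: eq_bigr => j _.
  rewrite mulrACA exprD; congr (_ * (_ * _)).
  have u : w ^+ k != 0.
    by rewrite expf_neq0// -normr_gt0 (prim_root_norm pw).
  apply: (@mulIf _ ((w ^+ k) ^+ j)); first by rewrite expf_neq0.
  rewrite exprVn mulVf; last exact: expf_neq0.
  rewrite -exprD subnK; last exact: ltnW.
  by rewrite exprAC (prim_expr_order pw) expr1n.
rewrite exchange_big /= mulr_sumr; apply: eq_bigr => i _.
rewrite exchange_big /= (bigD1 i) //= [X in _ + X]big1 ?addr0.
  rewrite -mulr_sumr sum_prim_root// subnKC ?dvdnn; last exact: ltnW.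
  by rewrite mul1r mulrC.
move=> j ji; rewrite -mulr_sumr sum_prim_root//.
case: (boolP (n %| _)%N) => [|_]; last by rewrite mul0r mulr0.
move=> /dvdnP[m hm]; suff : (i : nat) = j by move/val_inj => ij; rewrite ij eqxx in ji.
have := ltn_ord i; have := ltn_ord j; clear -hm.
(* Since i, j < n, the exponent i + (n - j) lies strictly between 0 and 2n; the only multiple of n
   there is n itself. *)
case: m hm => [|[|m]]; first lia.
  rewrite mul1n; lia.
rewrite !mulSn; lia.
Qed.

(** Average 2 Re p = p + conj p against q at the inverse roots. The p half yields the sum of p_i
    q_i, the conjugate half only the constant term. As Re p is a nonnegative weight of mean Re p_0,
    the average is at most 2 B Re p_0. *)
Lemma norm_sum_coef_le (C : numClosedFieldType) (p q : {poly C}) (B : C) :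
  (forall z, `|z| = 1 -> 0 <= 'Re p.[z]) -> (forall z, `|z| = 1 -> `|q.[z]| <= B) ->
  `|\sum_(i < size q) p`_i * q`_i + (p`_0)^*%R * q`_0| <= 2 * B * 'Re p`_0.
Proof.
(* The order n must bound the size of the product [pc * q] below, not only those of p and q. *)
move=> p0 qB; pose n := maxn (size p + size q).+1 1.
have sp : (size p <= n)%N by rewrite /n; lia.
have sq : (size q <= n)%N by rewrite /n; lia.
have n0 : (0 < n)%N by rewrite /n; lia.
have [w pw] := @prim_root_exists C n n0.
have nw (k : nat) : `|w ^+ k| = 1 by rewrite normrX (prim_root_norm pw) expr1n.
have nw' (k : nat) : `|(w ^+ k)^-1| = 1 by rewrite normfV nw invr1.
have nC0 : 0 < (n%:R : C) by rewrite ltr0n.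
have E1 := sum_horner_prim_root pw sp sq.
(* On the unit circle the conjugate of p(z) is [pc] at 1/z, so the conjugate half is an average of
   the single polynomial [pc * q]. *)
pose pc := map_poly (@Num.conj C) p.
have spc : size pc = size p by rewrite /pc size_map_poly.
have spq : (size (pc * q)%R <= n)%N.
  by apply: leq_trans (size_polyMleq pc q) _; rewrite spc /n; lia.
have E2 : \sum_(k < n) (p.[w ^+ k])^*%R * q.[(w ^+ k)^-1] = n%:R * ((p`_0)^*%R * q`_0).
  (* Pairing with the constant polynomial 1 isolates the constant coefficient. *)
  have s1 : (size (1%:P : {poly C}) <= n)%N by rewrite size_polyC oner_eq0.
  have := sum_horner_prim_root pw s1 spq.
  have -> : \sum_(i < n) (1%:P : {poly C})`_i * (pc * q)`_i = (p`_0)^*%R * q`_0.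
    rewrite (bigD1 (Ordinal n0)) //= big1 ?addr0; last first.
      by move=> i; rewrite -val_eqE /= => i0; rewrite coefC (negbTE i0) mul0r.
    by rewrite coefC eqxx mul1r coef0M coef_map.
  move=> <-; apply: eq_bigr => k _; rewrite hornerC mul1r hornerM; congr (_ * _).
  by rewrite invC_norm nw expr1n invr1 mul1r horner_map.
have E3 : \sum_(i < n) p`_i * q`_i = \sum_(i < size q) p`_i * q`_i.
  rewrite (big_ord_widen n (fun i => p`_i * q`_i) sq).
  rewrite [LHS](bigID (fun i : 'I_n => (i < size q)%N)) /=.
  rewrite [X in _ + X]big1 ?addr0// => i; rewrite -leqNgt => qi.
  by rewrite (nth_default _ qi) mulr0.
have E4 : \sum_(k < n) 'Re p.[w ^+ k] = n%:R * 'Re p`_0.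
  have s1 : (size (1%:P : {poly C}) <= n)%N by rewrite size_polyC oner_eq0.
  have h := sum_horner_prim_root pw sp s1.
  have h' : \sum_(k < n) p.[w ^+ k] = n%:R * p`_0.
    rewrite -[LHS](eq_bigr _ (fun k _ => mulr1 _)).
    transitivity (\sum_(k < n) p.[w ^+ k] * (1%:P).[(w ^+ k)^-1]).
      by apply: eq_bigr => k _; rewrite hornerC.
    rewrite h; congr (_ * _); rewrite (bigD1 (Ordinal n0)) //= big1 ?addr0.
      by rewrite coefC eqxx mulr1.
    by move=> i; rewrite -val_eqE /= => i0; rewrite coefC (negbTE i0) mulr0.
  by rewrite -raddf_sum h' -[n%:R]/(n%:R) /= ReMl ?rpred_nat.
rewrite -(ler_pM2l nC0) -[X in X * `|_|]normr_nat -normrM mulrDr -E3 -E1 -E2 -big_split /=.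
rewrite [leRHS]mulrCA -E4 mulr_sumr.
apply: le_trans (ler_norm_sum _ _ _) _; apply: ler_sum => k _.
rewrite -mulrDl normrM.
have -> : `|p.[w ^+ k] + (p.[w ^+ k])^*%R| = 2 * 'Re p.[w ^+ k].
  have e : p.[w ^+ k] + (p.[w ^+ k])^*%R = 2 * 'Re p.[w ^+ k].
    by rewrite ReE mulrC divfK ?pnatr_eq0.
  by rewrite e ger0_norm ?mulr_ge0// p0.
rewrite mulrAC; apply: ler_wpM2r; first exact: p0.
by apply: ler_wpM2l; rewrite ?qB.
Qed.

(** * Monotonicity of the area, and the area of a disc *)

Lemma ge0_le_integralT d (T : measurableType d) (R : realType) (mu : {measure set T -> \bar R})
  (f g : T -> \bar R) : (forall x, 0 <= f x)%E -> (forall x, f x <= g x)%E ->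
  (\int[mu]_x f x <= \int[mu]_x g x)%E.
Proof.
move=> f0 fg; rewrite !ge0_integralTE//; last by move=> x; rewrite (le_trans _ (fg x)).
apply: ge_ereal_sup => _ [h/= hf] <-.
by apply: ereal_sup_ubound; exists h => // x; exact: le_trans (hf x) (fg x).
Qed.

(* The sets need not be measurable: sections are compared through the outer
   measure, and the integral of a nonnegative function is a supremum over the
   simple functions below it. *)
Lemma le_area (R : realType) (A B : set R[i]) : A `<=` B -> (area A <= area B)%E.
Proof.
move=> AB; apply: ge0_le_integralT => x //=.
apply: le_outer_measure => y; rewrite /xsection /= !inE => -[w Aw <-].
by exists w => //; apply: AB.
Qed.

(** This is what remains of the area of the unit disc after the substitution x = sin t; an
    antiderivative is x + sin x cos x. *)
Lemma integral_cos2 (R : realType) :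
  (\int[lebesgue_measure]_(x in `[(- (pi / 2) : R)%R, (pi / 2)%R]) (2 * cos x ^+ 2)%:E
   = (@pi R)%:E)%E.
Proof.
pose f := fun x : R => 2 * cos x ^+ 2 : R.
have p0 : 0 < (pi / 2 : R) by rewrite divr_gt0// pi_gt0.
have dF (x : R) : is_derive x 1 (fun x : R => x + sin x * cos x) (2 * cos x ^+ 2).
  apply: is_derive_eq; rewrite /GRing.scale /=; have := sin2cos2 x; nra.
have cF : continuous (fun x : R => x + sin x * cos x).
  by move=> x; apply/differentiable_continuous/derivable1_diffP; have [] := dF x.
rewrite (@continuous_FTC2 _ f (fun x : R => x + sin x * cos x)).
- by rewrite sin_pihalf cosN sinN cos_pihalf !mulr0 !addr0 -EFinB; congr (_%:E); lra.
- lra.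
- apply: continuous_subspaceT => x; apply: cvgM; first exact: cvg_cst.
  by apply: cvgM; exact: continuous_cos.
- split.
  + by move=> x _; have [] := dF x.
  + by apply: cvg_at_right_filter; exact: cF.
  + by apply: cvg_at_left_filter; exact: cF.
- by move=> x _; rewrite derive1E; have [_] := dF x.
Qed.

(** The vertical section over x is an open interval of half-length the square root. *)
Lemma area_disc_sqrt (R : realType) (u rho : R) : 0 < rho ->
  (area [set w : R[i] | ((complex.Re w - u) ^+ 2 + complex.Im w ^+ 2 < rho ^+ 2)%R]
   = \int[lebesgue_measure]_(x in `[(u - rho)%R, (u + rho)%R])
        (2 * Num.sqrt (rho ^+ 2 - (x - u) ^+ 2))%R%:E)%E.
Proof.
move=> rho0; rewrite integral_mkcond; apply: eq_integral => x _ /=.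
set X := xsection _ x.
have -> : X = [set` `](- Num.sqrt (rho ^+ 2 - (x - u) ^+ 2)),
    (Num.sqrt (rho ^+ 2 - (x - u) ^+ 2))[].
  apply/seteqP; split => y; rewrite /X /xsection /= inE /= in_itv /=.
    move=> [[w1 w2] /= + [<- <-]]; rewrite -ltr_norml => h.
    rewrite -sqrtr_sqr ltr_sqrt; first by rewrite ltrBrDl.
    by rewrite subr_gt0; apply: le_lt_trans h; rewrite lerDl sqr_ge0.
  rewrite -ltr_norml -sqrtr_sqr => h; exists (x +i* y)%C => //=.
  have := le_lt_trans (sqrtr_ge0 _) h.
  rewrite sqrtr_gt0 => h0; move: h; rewrite ltr_sqrt//.
  by rewrite ltrBrDl.
rewrite lebesgue_measure_itv /= lte_fin -EFinB.
set s := Num.sqrt _; have s0 : 0 <= s by exact: sqrtr_ge0.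
have -> : (if - s < s then (s - - s)%:E else 0%E) = (2 * s)%:E.
  case: ifPn; first by move=> _; congr (_%:E); ring.
  by rewrite -leNgt => h; congr (_%:E); lra.
(* Off the segment the radicand is nonpositive and [Num.sqrt] takes its default value 0, matching
   the empty section. *)
rewrite patchE; case: ifPn => //; rewrite notin_setE /= in_itv /= => h.
congr (_%:E); rewrite /s ler0_sqrtr ?mulr0//.
have : ~~ (`|x - u| <= rho).
  apply/negP; rewrite ler_norml => /andP[h1 h2]; apply: h; apply/andP; split; lra.
rewrite -ltNge subr_le0 -[leRHS]real_normK ?num_real// => h'.
by rewrite ler_sqr ?nnegrE ?(ltW rho0)// ltW.
Qed.

(** Substitute x = u + rho sin t on [-pi/2, pi/2], where cos t >= 0: the integrand becomes 2 rho^2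
    cos^2 t. *)
Lemma integral_sqrt_disc (R : realType) (u rho : R) : 0 < rho ->
  (\int[lebesgue_measure]_(x in `[(u - rho)%R, (u + rho)%R])
      (2 * Num.sqrt (rho ^+ 2 - (x - u) ^+ 2))%R%:E
  = (pi * rho ^+ 2)%R%:E)%E.
Proof.
move=> rho0; pose F := fun t : R => u + rho * sin t.
pose G := fun x : R => 2 * Num.sqrt (rho ^+ 2 - (x - u) ^+ 2) : R.
have p0 : 0 < (pi / 2 : R) by rewrite divr_gt0// pi_gt0.
have dF (t : R) : is_derive t 1 F (rho * cos t).
  by apply: is_derive_eq; rewrite /GRing.scale /=; ring.
have cF : continuous F.
  by move=> x; apply/differentiable_continuous/derivable1_diffP; have [] := dF x.
have F'E : derive1 F = (fun t => rho * cos t).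
  by apply/funext => t; rewrite derive1E; have [_] := dF t.
have cF' : continuous (derive1 F).
  by rewrite F'E => t; apply: cvgM; [exact: cvg_cst|exact: continuous_cos].
have Fa : u - rho = F (- (pi / 2)) by rewrite /F sinN sin_pihalf; ring.
have Fb : u + rho = F (pi / 2) by rewrite /F sin_pihalf; ring.
rewrite Fa Fb (@integration_by_substitution_increasing _ F G).
- transitivity (\int[lebesgue_measure]_(t in `[(- (pi / 2) : R)%R, (pi / 2)%R])
      ((rho ^+ 2)%:E * (2 * cos t ^+ 2)%:E))%E.
    apply: eq_integral => t; rewrite inE /= in_itv /= => ht.
    rewrite F'E -EFinM; congr (_%:E); rewrite /G /F /=.
    change (2 * Num.sqrt (rho ^+ 2 - (u + rho * sin t - u) ^+ 2)
      * (rho * cos t) = rho ^+ 2 * (2 * cos t ^+ 2)).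
    have -> : rho ^+ 2 - (u + rho * sin t - u) ^+ 2 = (rho * cos t) ^+ 2.
      by have := sin2cos2 t; nra.
    rewrite sqrtr_sqr ger0_norm; first by ring.
    by rewrite mulr_ge0 ?(ltW rho0)// cos_ge0_pihalf.
  rewrite integralZl//=.
    by rewrite integral_cos2 -EFinM mulrC.
  apply: continuous_compact_integrable; first exact: segment_compact.
  apply: continuous_subspaceT => x; apply: cvgM; first exact: cvg_cst.
  by apply: cvgM; exact: continuous_cos.
- lra.
- move=> x y; rewrite !in_itv /= => xi yi xy.
  by rewrite /F ltrD2l ltr_pM2l// ltr_sin.
- by move=> x _; exact: cF'.
- by apply/cvg_ex; exists ((derive1 F) (- (pi / 2))); apply: cvg_at_right_filter; exact: cF'.
- by apply/cvg_ex; exists ((derive1 F) (pi / 2)); apply: cvg_at_left_filter; exact: cF'.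
- split.
  + by move=> x _; have [] := dF x.
  + by apply: cvg_at_right_filter; exact: cF.
  + by apply: cvg_at_left_filter; exact: cF.
- apply: continuous_subspaceT => x; apply: cvgM; first exact: cvg_cst.
  apply: continuous_comp; last exact: sqrt_continuous.
  apply: cvgB; first exact: cvg_cst.
  by apply: cvgM; apply: cvgB => //; exact: cvg_cst.
Qed.

Lemma area_disc (R : realType) (u rho : R) : 0 <= rho ->
  (area [set w : R[i] | ((complex.Re w - u) ^+ 2 + complex.Im w ^+ 2 < rho ^+ 2)%R]
   = (pi * rho ^+ 2)%R%:E)%E.
Proof.
rewrite le_eqVlt => /predU1P[<-|rho0]; last by rewrite area_disc_sqrt// integral_sqrt_disc.
rewrite expr0n /= mulr0 (_ : [set w | _] = set0); last first.
  by apply/seteqP; split => // w /=; rewrite ltNge addr_ge0 ?sqr_ge0.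
rewrite /area image_set0.
exact: measure0.
Qed.

(** * Power series on the disc *)

Lemma norm_Re (R : realType) (z : R[i]) : `|z| = (complex.Re `|z|)%:C.
Proof. by rewrite RRe_real// normr_real. Qed.

(** Epsilon form of convergence with a real epsilon: the norm of [R[i]] is complex-valued, but its
    positive elements are real. *)
Lemma has_expansionP (R : realType) (f : R[i] -> R[i]) (a : nat -> R[i]) :
  has_expansion f a <-> forall z, disk 1 z -> forall e : R, 0 < e ->
    exists N, forall n, (N <= n)%N -> `|f z - \sum_(i < n) a i * z ^+ i| <= e%:C.
Proof.
split=> h z z1.
  move=> e e0; have e0' : 0 < e%:C by rewrite ltcR.
  have /cvgr_dist_le/(_ _ e0')[N _ hN] := h z z1.
  by exists N => n Nn; have := hN n Nn; rewrite /series /= big_mkord.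
apply/cvgrPdist_le => e e0.
have er : e = (complex.Re e)%:C by rewrite RRe_real// gtr0_real.
have [|N hN] := h z z1 (complex.Re e); first by rewrite -ltcR -er.
by exists N => // n Nn; rewrite er /series /= big_mkord; exact: hN.
Qed.

Lemma expr_small (R : realType) (q e : R) : 0 <= q < 1 -> 0 < e ->
  exists N, forall n, (N <= n)%N -> q ^+ n <= e.
Proof.
move=> /andP[q0 q1] e0.
have /cvgr_dist_le/(_ _ e0)[N _ hN] : q ^+ n @[n --> \oo] --> 0.
  by apply: cvg_expr; rewrite ger0_norm.
exists N => n Nn; have := hN n Nn.
by rewrite /= sub0r normrN ger0_norm// exprn_ge0.
Qed.

Lemma geometric_sum_le (R : realFieldType) (q : R) (m n : nat) : 0 <= q < 1 -> (m <= n)%N ->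
  \sum_(m <= i < n) q ^+ i <= q ^+ m / (1 - q).
Proof.
move=> /andP[q0 q1] mn; rewrite ler_pdivlMr ?subr_gt0// mulr_suml.
rewrite (eq_bigr (fun i => - (q ^+ i.+1 - q ^+ i))); last by move=> i _; rewrite exprS; ring.
by rewrite sumrN telescope_sumr// opprB gerBl exprn_ge0.
Qed.

(** A term is the difference of two consecutive partial sums, both eventually within 1/2 of the
    value of f. *)
Lemma expansion_terms_le1 (R : realType) (f : R[i] -> R[i]) (a : nat -> R[i]) (t : R) :
  has_expansion f a -> 0 <= t < 1 ->
  exists N, forall n, (N <= n)%N -> `|a n| * t%:C ^+ n <= 1.
Proof.
move=> /has_expansionP h /andP[t0 t1].
have nt : `|t%:C| = t%:C by rewrite ger0_norm// lecR.
have [|//|N hN] := h t%:C _ (2^-1) _; first by rewrite /disk /= nt ltcR.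
exists N => n Nn; rewrite -nt -normrX -normrM.
have -> : a n * t%:C ^+ n = (f t%:C - \sum_(i < n) a i * t%:C ^+ i)
    - (f t%:C - \sum_(i < n.+1) a i * t%:C ^+ i).
  by rewrite big_ord_recr /=; ring.
apply: le_trans (ler_normB _ _) _.
have := lerD (hN _ Nn) (hN _ (leqW Nn)); move=> /le_trans; apply.
by rewrite -rmorphD /= lecR; lra.
Qed.

(** For s < t < 1 the terms on the circle of radius s are eventually at most (s/t)^i, a geometric
    tail that does not depend on z. *)
Lemma expansion_uniform (R : realType) (f : R[i] -> R[i]) (a : nat -> R[i]) (s e : R) :
  has_expansion f a -> 0 <= s < 1 -> 0 < e ->
  exists T0, forall T, (T0 <= T)%N -> forall z : R[i], `|z| = s%:C ->
    `|f z - \sum_(i < T) a i * z ^+ i| <= e%:C.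
Proof.
move=> h /andP[s0 s1] e0.
pose t := (1 + s) / 2; have t0 : 0 < t by rewrite /t; lra.
have t01 : 0 <= t < 1 by rewrite /t; lra.
have [N hN] := expansion_terms_le1 h t01.
pose q := s / t; have q01 : 0 <= q < 1.
  rewrite /q; apply/andP; split; first by rewrite divr_ge0// ltW.
  by rewrite ltr_pdivrMr// /t; lra.
have e1 : 0 < e / 2 * (1 - q) by rewrite mulr_gt0; lra.
have [N' hN'] := expr_small q01 e1.
exists (maxn N N') => T; rewrite geq_max => /andP[NT N'T] z zs.
have z1 : disk 1 z by rewrite /disk /= zs ltcR.
(* This [M] depends on z; it only serves to cut the remainder at a finite rank, and the bound on the
   part from T to S is independent of it. *)
have [|M hM] := (has_expansionP f a).1 h z z1 (e / 2); first by lra.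
pose S := maxn M T.
have -> : f z - \sum_(i < T) a i * z ^+ i =
   (f z - \sum_(i < S) a i * z ^+ i) + \sum_(T <= i < S) a i * z ^+ i.
  rewrite -(big_mkord xpredT (fun i => a i * z ^+ i)) -(big_mkord xpredT (fun i => a i * z ^+ i)).
  rewrite (big_cat_nat (n := T) (leq0n _) (leq_maxr _ _)) /=; ring.
apply: le_trans (ler_normD _ _) _.
rewrite [e in leRHS](_ : e = e / 2 + e / 2); last by lra.
rewrite rmorphD /=; apply: lerD; first by apply: hM; exact: leq_maxl.
apply: le_trans (ler_norm_sum _ _ _) _.
have h1 : \sum_(T <= i < S) `|a i * z ^+ i| <= \sum_(T <= i < S) (q ^+ i)%:C.
  apply: ler_sum_nat => i /andP[Ti _]; rewrite normrM normrX zs.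
  have -> : s%:C ^+ i = t%:C ^+ i * (q ^+ i)%:C.
    by rewrite -!rmorphXn -rmorphM /= -exprMn mulrC divfK// gt_eqF.
  rewrite mulrA -[leRHS]mul1r; apply: ler_wpM2r; last by apply: hN; lia.
  by rewrite lecR exprn_ge0//; lra.
apply: le_trans h1 _; rewrite -rmorph_sum lecR.
apply: le_trans (geometric_sum_le q01 (leq_maxr _ _)) _.
by rewrite ler_pdivrMr; [exact: hN'|lra].
Qed.

(** * The coefficient functional for functions of real part below 1 *)

Lemma ReB (R : realType) (x y : R[i]) : complex.Re (x - y) = complex.Re x - complex.Re y.
Proof. by case: x y => [? ?] [? ?]. Qed.

(** [norm_sum_coef_le] gives the bound for the dilation f(s z) with a slack e; both are removed at
    once by taking s = 1 - e. *)
Lemma classP_coef_functional (R : realType) (f : R[i] -> R[i]) (a : nat -> R[i]) (a0 : R)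
    (q : {poly R[i]}) (n : nat) (B : R) :
  (forall z, disk 1 z -> complex.Re (f z) < 1) -> has_expansion f a -> a 0%N = a0%:C ->
  (size q <= n)%N -> (forall z, `|z| = 1 -> `|q.[z]| <= B%:C) ->
  `|2 * (1 - a0)%:C * q`_0 - \sum_(1 <= i < n) a i * q`_i| <= (2 * B * (1 - a0))%:C.
Proof.
move=> f1 ha a00 qn qB.
have -> : \sum_(1 <= i < n) a i * q`_i = \sum_(1 <= i < size q) a i * q`_i.
  rewrite (big_nat_widen _ _ _ _ _ qn) [RHS]big_mkcond; apply: eq_bigr => i _ /=.
  by case: ltnP => // iq; rewrite nth_default// mulr0.
have B0 : 0 <= B.
  by rewrite -lecR; apply: le_trans (qB 1 (normr1 _)); exact: normr_ge0.
(* [S s] is the linear form for f(s z). The slack e in the constant coefficient of p contributes the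
   extra 2 e q_0. *)
pose S (s : R) := 2 * (1 - a0)%:C * q`_0 - \sum_(1 <= i < size q) a i * s%:C ^+ i * q`_i.
have key (s e : R) : 0 < s < 1 -> 0 < e ->
    `|S s + 2 * e%:C * q`_0| <= (2 * B * (1 - a0 + e))%:C.
  move=> /andP[s0 s1] e0.
  have s01 : 0 <= s < 1 by lra.
  have [T0 hT0] := expansion_uniform ha s01 e0.
  (* T is beyond the size of q, so every coefficient of f paired with q survives the truncation, and
     T > 0 even when q = 0. *)
  pose T := maxn T0 (size q).+1.
  pose p : {poly R[i]} := (1 + e)%:C%:P - \poly_(i < T) (a i * s%:C ^+ i).
  have pE z : p.[z] = (1 + e)%:C - \sum_(i < T) a i * (s%:C * z) ^+ i.
    rewrite /p hornerD hornerN hornerC horner_poly; congr (_ - _).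
    by apply: eq_bigr => i _; rewrite exprMn mulrA.
  have p0 z : `|z| = 1 -> 0 <= 'Re p.[z].
    move=> z1; rewrite -complexRe ler0c pE.
    have zs : `|s%:C * z| = s%:C by rewrite normrM z1 mulr1 ger0_norm// lecR ltW.
    have := hT0 T (leq_maxl _ _) _ zs; set X := \sum_(i < T) _ => hX.
    have fz : complex.Re (f (s%:C * z)) < 1 by apply: f1; rewrite /disk /= zs ltcR.
    have := le_trans (normc_ge_Re _) hX; rewrite lecR ler_norml => /andP[hX' _].
    by rewrite ReB /=; move: hX' fz; rewrite ReB; lra.
  have p00 : p`_0 = (1 - a0 + e)%:C.
    rewrite /p coefB coefC eqxx coef_poly (_ : (0 < T)%N); last by rewrite /T; lia.
    by rewrite expr0 mulr1 a00 -rmorphB /=; congr (_%:C); ring.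
  have pS i : (0 < i < size q)%N -> p`_i = - (a i * s%:C ^+ i).
    move=> /andP[i0 iq]; rewrite /p coefB coefC gtn_eqF// coef_poly sub0r.
    by rewrite (_ : (i < T)%N)// /T; lia.
  have := norm_sum_coef_le p0 qB; rewrite -complexRe p00.
  rewrite conj_Creal; last by apply/complex_realP; exists (1 - a0 + e).
  have -> : 2 * B%:C * (complex.Re (1 - a0 + e)%:C)%:C = (2 * B * (1 - a0 + e))%:C.
    by rewrite !rmorphM /= rmorph_nat.
  apply: le_trans; rewrite le_eqVlt; apply/orP; left; apply/eqP; congr (`|_|).
  rewrite -(big_mkord xpredT (fun i => p`_i * q`_i)).
  case: (posnP (size q)) => sq.
    by rewrite /S sq !big_geq// nth_default ?sq//; ring.
  have -> : \sum_(0 <= i < size q) p`_i * q`_i =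
      p`_0 * q`_0 - \sum_(1 <= i < size q) a i * s%:C ^+ i * q`_i.
    rewrite big_ltn// -sumrN; congr (_ + _); apply: eq_big_nat => i hi.
    by rewrite pS// mulNr.
  by rewrite p00 /S rmorphD /=; ring.
(* K controls [S 1 - S s], by the inequality 1 - s^i <= i (1 - s). *)
pose K := \sum_(1 <= i < size q) i%:R * `|a i * q`_i|.
have K0 : 0 <= K by apply: sumr_ge0 => i _; rewrite mulr_ge0.
have Kr : K = (complex.Re K)%:C by rewrite RRe_real// ger0_real.
have q0r := norm_Re q`_0.
set k := complex.Re K in Kr; set m := complex.Re _ in q0r.
have k0 : 0 <= k by move: K0; rewrite Kr lecR.
have m0 : 0 <= m by move: (normr_ge0 q`_0); rewrite q0r lecR.
have lS s : 0 < s < 1 -> `|S 1 - S s| <= ((1 - s) * k)%:C.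
  move=> /andP[s0 s1]; rewrite rmorphM /= -Kr.
  have -> : S 1 - S s = \sum_(1 <= i < size q) a i * s%:C ^+ i * q`_i
      - \sum_(1 <= i < size q) a i * 1%:C ^+ i * q`_i.
    by rewrite /S opprB addrC subrKA.
  rewrite -sumrB /K mulr_sumr.
  apply: le_trans (ler_norm_sum _ _ _) _; apply: ler_sum => i _.
  rewrite (_ : _ - _ = (1 - s ^+ i)%:C * - (a i * q`_i)); last first.
    by rewrite rmorphB rmorphXn /= expr1n; ring.
  rewrite normrM normrN mulrA ler_wpM2r// ger0_norm; last first.
    by rewrite lecR subr_ge0 exprn_ile1// ltW.
  have -> : (1 - s)%:C * i%:R = ((1 - s) * i%:R)%:C by rewrite rmorphM /= rmorph_nat.
  rewrite lecR; elim: (i) => [|j IH]; first by rewrite expr0; lra.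
  by rewrite exprS -natr1; have : s ^+ j <= 1; [rewrite exprn_ile1// ltW | nra].
have -> : 2 * (1 - a0)%:C * q`_0 - \sum_(1 <= i < size q) a i * q`_i = S 1.
  by rewrite /S; congr (_ - _); apply: eq_bigr => i _; rewrite expr1n mulr1.
rewrite [leLHS]norm_Re.
rewrite lecR; apply/ler_addgt0Pr => d d0.
have D0 : 0 < k + 2 * m + 2 * B + 1 by lra.
(* The errors e k, 2 e m and 2 B e add up to at most d; the cap 1/2 keeps 1 - e inside (0, 1). *)
pose e := Num.min (1 / 2) (d / (k + 2 * m + 2 * B + 1)).
have e0 : 0 < e by rewrite lt_min divr_gt0//= divr_gt0.
have e2 : e <= 1 / 2 by rewrite ge_min lexx.
have ed : e * (k + 2 * m + 2 * B + 1) <= d by rewrite -ler_pdivlMr// ge_min lexx orbT.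
have s01 : 0 < 1 - e < 1 by lra.
have h1 := key _ _ s01 e0; have h2 := lS _ s01.
move: (S 1) (S (1 - e)) h1 h2 => S1 Se h1 h2.
have : `|S1| <= (2 * B * (1 - a0 + e) + e * k + 2 * e * m)%:C.
  rewrite (_ : S1 = (Se + 2 * e%:C * q`_0) + (S1 - Se) - 2 * e%:C * q`_0); last first.
    by rewrite addrAC addrK addrC subrK.
  apply: le_trans (ler_normB _ _) _; rewrite [leRHS]rmorphD /=; apply: lerD.
    apply: le_trans (ler_normD _ _) _; rewrite [leRHS]rmorphD /=; apply: lerD => //.
    by rewrite (_ : 1 - (1 - e) = e) in h2; last by ring.
  rewrite !normrM q0r normr_nat ger0_norm ?lecR ?(ltW e0)//.
  by rewrite !rmorphM /= rmorph_nat.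
rewrite [leLHS]norm_Re.
rewrite lecR => /le_trans; apply; nra.
Qed.

Lemma classP_coef_le (R : realType) (f : R[i] -> R[i]) (a : nat -> R[i]) (a0 : R) (n : nat) :
  (forall z, disk 1 z -> complex.Re (f z) < 1) -> has_expansion f a -> a 0%N = a0%:C ->
  (0 < n)%N -> `|a n| <= (2 * (1 - a0))%:C.
Proof.
move=> f1 ha a00 n0.
have sX : (size ('X^n : {poly R[i]}) <= n.+1)%N by rewrite size_polyXn.
have hB (z : R[i]) : `|z| = 1 -> `|('X^n).[z]| <= (1 : R)%:C.
  by move=> z1; rewrite hornerXn normrX z1 expr1n.
have := classP_coef_functional f1 ha a00 sX hB.
rewrite coefXn ltn_eqF// mulr0 sub0r normrN big_nat_recr//= coefXn eqxx mulr1.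
rewrite big_nat big1 ?add0r; last first.
  by move=> i /andP[i0 iN]; rewrite coefXn ltn_eqF// mulr0.
by rewrite mulr1.
Qed.

(** * The Schwarz-Pick bound and the image of a subdisc *)

Lemma halfplane_kernel (R : realType) (w : R[i]) (rho : R) : `|w| = rho%:C -> rho < 1 ->
  `|(1 + w) / (1 - w) - ((1 + rho ^+ 2) / (1 - rho ^+ 2))%:C| = (2 * rho / (1 - rho ^+ 2))%:C.
Proof.
move=> wr r1.
have r0 : 0 <= rho by rewrite -lecR -wr; exact: normr_ge0.
have d0 : 0 < 1 - rho ^+ 2 by nra.
have w1 : 1 - w != 0.
  by apply/eqP => /subr0_eq h; move: wr; rewrite -h normr1 => /complexI; lra.
have ww : w * w^*%C = (rho ^+ 2)%:C by rewrite -sqr_normc wr rmorphXn.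
have dC : (1 - rho ^+ 2)%:C != 0 :> R[i].
  by rewrite -(rmorph0 (real_complex R)) (inj_eq (@complexI R)) gt_eqF.
(* The quotient of 1 - conj w by 1 - w is unimodular, so the modulus of the right-hand side can be
   read off. *)
have -> : (1 + w) / (1 - w) - ((1 + rho ^+ 2) / (1 - rho ^+ 2))%:C
   = 2 * w * ((1 - w)^*%C / (1 - w)) / (1 - rho ^+ 2)%:C.
  have e1 : (1 - rho ^+ 2)%:C = 1 - w * w^*%C by rewrite rmorphB rmorph1 /= ww.
  have e2 : (1 - w)^*%C = 1 - w^*%C by rewrite rmorphB rmorph1.
  rewrite e1 in dC.
  rewrite rmorphM /= fmorphV /= !e1 e2 rmorphD rmorph1 /= -ww; field.
  by apply/andP; split.
rewrite !normrM !normfV normcJ divff ?normr_eq0// mulr1 wr normr_nat.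
rewrite [`|(1 - _)%:C|]ger0_norm ?lecR ?(ltW d0)//.
by rewrite !rmorphM /= fmorphV rmorph_nat.
Qed.

(** Pairing the coefficients with (1 + z X) / (1 - z X) = 1 + 2 z X + 2 z^2 X^2 + ... recovers f(z).
    Subtracting the centre A of the circle on which the kernel takes its values lowers its sup norm
    to the radius B. *)
Lemma classP_schwarz (R : realType) (f : R[i] -> R[i]) (a : nat -> R[i]) (a0 : R)
    (z : R[i]) (rho : R) :
  (forall z, disk 1 z -> complex.Re (f z) < 1) -> has_expansion f a -> a 0%N = a0%:C ->
  `|z| = rho%:C -> rho < 1 ->
  `|f z - (1 - (1 - a0) * ((1 + rho ^+ 2) / (1 - rho ^+ 2)))%:C|
     <= ((1 - a0) * (2 * rho / (1 - rho ^+ 2)))%:C.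
Proof.
move=> f1 ha a00 zr r1.
set A := (1 + rho ^+ 2) / _; set B := 2 * rho / _; set c := 1 - a0.
have r0 : 0 <= rho by rewrite -lecR -zr; exact: normr_ge0.
have z1 : disk 1 z by rewrite /disk /= zr ltcR.
have c0 : 0 <= c.
  have := classP_coef_le f1 ha a00 (ltn0Sn 0) => /(le_trans (normr_ge0 _)).
  by rewrite lecR /c; lra.
rewrite [leLHS]norm_Re.
rewrite lecR; apply/ler_addgt0Pr => d' d'0.
(* Truncating the kernel costs c d and truncating f costs d. *)
pose d := d' / (1 + c).
have dd : d' = d * (1 + c) by rewrite /d divfK// gt_eqF//; lra.
have d0 : 0 < d by rewrite /d divr_gt0//; lra.
have rr : 0 <= rho < 1 by rewrite r0.
(* Chosen so that the kernel tail, at most 2 rho^(M+1) / (1 - rho), does not exceed d. *)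
have e0 : 0 < d * (1 - rho) / 2 by rewrite divr_gt0// mulr_gt0//; lra.
have [N1 hN1] := expr_small rr e0.
have [N2 hN2] := (has_expansionP f a).1 ha z z1 d d0.
pose M := maxn N1 N2.
pose q : {poly R[i]} := \poly_(i < M.+1) (if i == 0%N then (1 - A)%:C else 2 * z ^+ i).
have sq : (size q <= M.+1)%N by exact: size_poly.
have qB (t : R[i]) : `|t| = 1 -> `|q.[t]| <= (B + d)%:C.
  move=> t1; pose w := z * t.
  have wr : `|w| = rho%:C by rewrite /w normrM t1 mulr1.
  have w1 : 1 - w != 0.
    by apply/eqP => /subr0_eq h; move: wr; rewrite -h normr1 => /complexI; lra.
  have -> : q.[t] = ((1 + w) / (1 - w) - A%:C) - 2 * w ^+ M.+1 / (1 - w).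
    rewrite horner_poly big_ord_recl /= expr0 mulr1.
    rewrite (eq_bigr (fun i : 'I_M => 2 * w * w ^+ i)); last first.
      by move=> i _; rewrite /bump add1n /= -[LHS]mulrA -exprMn exprS mulrA.
    rewrite -mulr_sumr rmorphB rmorph1.
    have h : \sum_(i < M) w ^+ i = (1 - w ^+ M) / (1 - w).
      by rewrite -[1 - w ^+ M]opprB subrX1 -mulNr opprB mulrC mulKf.
    by rewrite h exprS; field.
  apply: le_trans (ler_normB _ _) _; rewrite rmorphD /=; apply: lerD.
    by rewrite (halfplane_kernel wr r1).
  rewrite !normrM normr_nat normfV normrX wr.
  have h1 : (1 - rho)%:C <= `|1 - w|.
    by have := lerB_dist 1 w; rewrite normr1 wr rmorphB.
  have p1 : 0 < (1 - rho)%:C :> R[i] by rewrite ltcR; lra.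
  rewrite ler_pdivrMr; last exact: lt_le_trans h1.
  apply: le_trans (ler_wpM2l _ h1); last by rewrite lecR ltW.
  rewrite -rmorphXn -(rmorph_nat (real_complex R)) -!rmorphM /= lecR.
  have MN1 : (N1 <= M.+1)%N by rewrite /M; lia.
  have := hN1 _ MN1; rewrite ler_pdivlMr//; lra.
have := classP_coef_functional f1 ha a00 sq qB.
rewrite coef_poly /=.
rewrite (eq_big_nat _ _ (F2 := fun i => 2 * (a i * z ^+ i))); last first.
  by move=> i /andP[i0 iM]; rewrite coef_poly iM gtn_eqF//; ring.
rewrite -mulr_sumr -mulrA -mulrBr normrM normr_nat.
have -> : (2 * (B + d) * (1 - a0))%:C = 2 * ((B + d) * c)%:C.
  by rewrite -mulrA rmorphM /= rmorph_nat.
rewrite ler_pM2l// => h.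
have hM : `|f z - \sum_(i < M.+1) a i * z ^+ i| <= d%:C by apply: hN2; rewrite /M; lia.
have : `|f z - (1 - c * A)%:C| <= (c * B + d')%:C.
  have -> : f z - (1 - c * A)%:C = (f z - \sum_(i < M.+1) a i * z ^+ i)
     - ((1 - a0)%:C * (1 - A)%:C - \sum_(1 <= i < M.+1) a i * z ^+ i).
    rewrite -(big_mkord xpredT (fun i => a i * z ^+ i)) big_ltn// a00 expr0 mulr1.
    rewrite /c !rmorphB !rmorphM /= !rmorphB !rmorph1 /=; ring.
  apply: le_trans (ler_normB _ _) _.
  apply: le_trans (lerD hM h) _; rewrite -rmorphD lecR dd; lra.
rewrite [leLHS]norm_Re.
by rewrite lecR.
Qed.

Lemma ltr_normc (R : realType) (w : R[i]) (u r : R) : 0 <= r ->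
  (`|w - u%:C| < r%:C) = ((complex.Re w - u) ^+ 2 + complex.Im w ^+ 2 < r ^+ 2).
Proof.
move=> r0; rewrite normc_def ltcR -[in LHS](ger0_norm r0) -sqrtr_sqr.
case: w => x y /=; rewrite subr0.
case: (ltrP 0 (r ^+ 2)) => h; first by rewrite ltr_sqrt.
rewrite (ler0_sqrtr h) [LHS]ltNge sqrtr_ge0; apply/esym/negbTE; rewrite -leNgt.
by apply: le_trans h _; rewrite addr_ge0// sqr_ge0.
Qed.

(** The bound at s = |z| puts f(z) in a closed disc depending on s. As s grows to r the centre moves
    left and the right end moves strictly right, so this disc lies in the open disc for r. *)
Lemma classP_image_subset (R : realType) (f : R[i] -> R[i]) (a : nat -> R[i]) (a0 r : R) :
  (forall z, disk 1 z -> complex.Re (f z) < 1) -> has_expansion f a -> a 0%N = a0%:C ->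
  a0 < 1 -> 0 <= r < 1 ->
  f @` disk r `<=` [set w | (complex.Re w - (1 - (1 - a0) * ((1 + r ^+ 2) / (1 - r ^+ 2)))) ^+ 2
     + complex.Im w ^+ 2 < ((1 - a0) * (2 * r / (1 - r ^+ 2))) ^+ 2].
Proof.
move=> f1 ha a00 a01 /andP[r0 r1] _ [z zr <-] /=.
have dr : 0 < 1 - r ^+ 2 by nra.
rewrite -ltr_normc; last by rewrite mulr_ge0 ?divr_ge0 ?mulr_ge0//; lra.
have zE := norm_Re z.
set s := complex.Re _ in zE.
have s0 : 0 <= s by move: (normr_ge0 z); rewrite zE lecR.
have sr : s < r by move: zr; rewrite /disk /= zE ltcR.
have ds : 0 < 1 - s ^+ 2 by nra.
have h := classP_schwarz f1 ha a00 zE (lt_trans sr r1).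
move: h; set us := 1 - _ * _; set ur := 1 - _ * _ => h.
have le1 : ur <= us.
  rewrite /ur /us lerD2l lerN2 ler_pM2l ?subr_gt0// ler_pdivrMr// mulrAC ler_pdivlMr//; nra.
rewrite (_ : f z - ur%:C = (f z - us%:C) + (us - ur)%:C); last first.
  by rewrite [(us - ur)%:C]rmorphB /=; ring.
apply: le_lt_trans (ler_normD _ _) _.
rewrite [`|(us - ur)%:C|]ger0_norm ?lecR ?subr_ge0//.
apply: le_lt_trans (lerD h (lexx _)) _.
rewrite -rmorphD ltcR /us /ur.
(* By this splitting, centre plus radius is 1 - (1 - a0) (1 - x) / (1 + x), which increases with
   x. *)
have e (x : R) : 0 <= x < 1 ->
    (1 + x ^+ 2) / (1 - x ^+ 2) = (1 - x) / (1 + x) + 2 * x / (1 - x ^+ 2).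
  move=> /andP[x0 x1]; have : 1 - x ^+ 2 != 0 by rewrite gt_eqF//; nra.
  by move=> ?; field; apply/andP; split => //; rewrite gt_eqF//; lra.
rewrite !e ?r0 ?s0//=; last by lra.
set X := 2 * s / _; set Y := 2 * r / _.
have : (1 - r) / (1 + r) < (1 - s) / (1 + s).
  by rewrite ltr_pdivrMr; last lra; rewrite mulrAC ltr_pdivlMr; [nra|lra].
set U := (1 - r) / _; set V := (1 - s) / _ => UV; nra.
Qed.

(** * The extremal function [psi] *)

Lemma disk_onem_neq0 (R : realType) (z : R[i]) : disk 1 z -> 1 - z != 0.
Proof.
by rewrite /disk /= => z1; apply/eqP => /subr0_eq h; move: z1; rewrite -h normr1 ltxx.
Qed.

Lemma psi_holomorphic (R : realType) (a0 : R) : holomorphic_on (disk 1) (@psi R a0).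
Proof.
move=> z /disk_onem_neq0 z1.
apply: derivableB; first exact: derivable_cst.
apply: derivableM; first exact: derivable_cst.
apply: derivableM; first exact: derivable_id.
apply: derivableV => //.
Qed.

Lemma Re_psi_lt1 (R : realType) (a0 : R) (z : R[i]) :
  a0 < 1 -> disk 1 z -> complex.Re (psi a0 z) < 1.
Proof.
move=> a01 z1; have hz := disk_onem_neq0 z1.
pose v := z / (1 - z).
have e1 : 1 + v = (1 - z)^-1 by rewrite /v; field.
(* This says Re v > -1/2, that is, Re (a0 - 2 (1 - a0) v) < 1. *)
have vlt : `|v| < `|1 + v|.
  rewrite e1 /v normrM -[ltRHS]mul1r ltr_pM2r//.
  by rewrite normr_gt0 invr_neq0.
have -> : complex.Re (psi a0 z) = a0 - 2 * (1 - a0) * complex.Re v.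
  rewrite /psi -/v -[2]/(2%:R) -(rmorph_nat (real_complex R)) -rmorphM /= ReB /=.
  by case: v {e1 vlt} => x y /=; rewrite mul0r subr0.
move: vlt; rewrite -ltr_sqr ?nnegrE// -!add_Re2_Im2 ltcR.
by case: (v) => x y /=; rewrite add0r => h; nra.
Qed.

Definition psi_coef (R : realType) (a0 : R) (n : nat) : R[i] :=
  if n == 0%N then a0%:C else (- (2 * (1 - a0)))%:C.

Lemma psi_expansion (R : realType) (a0 : R) : a0 < 1 -> has_expansion (psi a0) (psi_coef a0).
Proof.
move=> a01; apply/has_expansionP => z z1 e e0; have hz := disk_onem_neq0 z1.
have zE := norm_Re z.
have hE := norm_Re (1 - z).
move: zE hE; set s := complex.Re `|z|; set h := complex.Re _ => zE hE.
have s01 : 0 <= s < 1.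
  by move: (normr_ge0 z) z1; rewrite /disk /= zE lecR ltcR => -> ->.
have h0 : 0 < h by move: hz; rewrite -normr_gt0 hE ltcR.
have e1 : 0 < e * h / (2 * (1 - a0)) by rewrite divr_gt0 ?mulr_gt0//; lra.
have [N hN] := expr_small s01 e1.
exists N.+1 => -[//|n] Nn.
rewrite big_ord_recl /psi_coef /= expr0 mulr1.
rewrite (eq_bigr (fun i : 'I_n => (- (2 * (1 - a0)))%:C * z * z ^+ i)); last first.
  by move=> i _; rewrite /bump /= add1n exprS mulrA.
rewrite -mulr_sumr.
have hs : \sum_(i < n) z ^+ i = (1 - z ^+ n) / (1 - z).
  by rewrite -[1 - z ^+ n]opprB subrX1 -mulNr opprB mulrC mulKf.
have -> : psi a0 z - (a0%:C + (- (2 * (1 - a0)))%:C * z * \sum_(i < n) z ^+ i)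
   = - (2 * (1 - a0))%:C * (z ^+ n.+1 / (1 - z)).
  rewrite hs /psi exprS rmorphN rmorphM /= rmorph_nat; field.
  by [].
rewrite normrM normrN normrM normfV normrX zE hE -fmorphV -rmorphXn /=.
rewrite ger0_norm ?lecR; last by rewrite mulr_ge0//; lra.
rewrite -!rmorphM lecR mulrA ler_pdivrMr// mulrC -ler_pdivlMr; last by rewrite mulr_gt0//; lra.
by apply: hN; lia.
Qed.

(** One inclusion is the general one applied to [psi a0] itself; for the other, [psi a0] is inverted
    explicitly. *)
Lemma psi_image (R : realType) (a0 r : R) : a0 < 1 -> 0 <= r < 1 ->
  psi a0 @` disk r = [set w : R[i] |
     (complex.Re w - (1 - (1 - a0) * ((1 + r ^+ 2) / (1 - r ^+ 2)))) ^+ 2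
     + complex.Im w ^+ 2 < ((1 - a0) * (2 * r / (1 - r ^+ 2))) ^+ 2].
Proof.
move=> a01 r01; apply/seteqP; split.
  apply: (classP_image_subset _ (psi_expansion a01)) => // z.
  exact: Re_psi_lt1.
case/andP: r01 => r0 r1.
move=> [X Y] /= hw; have dr : 0 < 1 - r ^+ 2 by nra.
have dn : 1 - r ^+ 2 != 0 by rewrite gt_eqF.
pose c := 1 - a0; have c0 : 0 < c by rewrite /c; lra.
have cn : c != 0 by rewrite gt_eqF.
(* x + i y is v = z / (1 - z) for the preimage z, so z = v / (1 + v), and |z| < r means |v| < r |1 +
   v|. *)
pose x := (a0 - X) / (2 * c); pose y := - Y / (2 * c).
have XE : X = a0 - 2 * c * x by rewrite /x; field.
have YE : Y = - (2 * c * y) by rewrite /y; field.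
have hxy : (1 - r ^+ 2) * (x ^+ 2 + y ^+ 2) < r ^+ 2 * (1 + 2 * x).
  move: hw; rewrite XE YE -/c -subr_gt0 => hw.
  rewrite -subr_gt0 -(pmulr_rgt0 _ (_ : 0 < 4 * c ^+ 2 / (1 - r ^+ 2))); last first.
    by rewrite divr_gt0// mulr_gt0// exprn_gt0.
  move: hw; congr (0 < _); rewrite (_ : a0 = 1 - c); last by rewrite /c; ring.
  by field.
pose v : R[i] := x +i* y.
have hv : `|v| < r%:C * `|1 + v|.
  rewrite -ltr_sqr ?nnegrE; [|exact: normr_ge0|by rewrite mulr_ge0// lecR].
  rewrite exprMn -!add_Re2_Im2 -rmorphXn -rmorphM ltcR /=.
  by rewrite add0r; nra.
have v1 : 1 + v != 0.
  by apply/eqP => h; move: hv; rewrite h normr0 mulr0 normr_lt0.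
exists (v / (1 + v)).
  by rewrite /disk /= normrM normfV ltr_pdivrMr// normr_gt0.
have -> : psi a0 (v / (1 + v)) = a0%:C - (2 * c)%:C * v.
  rewrite /psi -/c rmorphM /= rmorph_nat; field.
  by rewrite v1 /= [_ - v](_ : _ = 1)//; ring.
by apply/eqP; rewrite eq_complex /= XE YE; apply/andP; split; apply/eqP; ring.
Qed.

Lemma image_area_psi (R : realType) (a0 r : R) : a0 < 1 -> 0 <= r < 1 ->
  image_area (psi a0) r = (pi * ((1 - a0) * (2 * r / (1 - r ^+ 2))) ^+ 2)%:E.
Proof.
move=> a01 /andP[r0 r1]; rewrite /image_area psi_image ?r0// area_disc//.
by rewrite mulr_ge0 ?divr_ge0 ?mulr_ge0//; nra.
Qed.

Lemma image_area_le_psi (R : realType) (f : R[i] -> R[i]) (a : nat -> R[i]) (a0 r : R) :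
  (forall z, disk 1 z -> complex.Re (f z) < 1) -> has_expansion f a -> a 0%N = a0%:C ->
  a0 < 1 -> 0 <= r < 1 -> (image_area f r <= image_area (psi a0) r)%E.
Proof.
move=> f1 ha a00 a01 r01; apply: le_area; rewrite psi_image//.
exact: classP_image_subset ha a00 _ _.
Qed.

(** * Comparison of Bohr sums *)

Lemma classF_cvg (R : realType) (zeta : nat -> R -> R) (r : R) : classF zeta -> 0 <= r < 1 ->
  cvgn (fun N => \sum_(1 <= n < N) zeta n r).
Proof.
move=> [_ _ [Z hZ]] r01; have [U nU cU] := hZ r r01.
have rU : (U `&` `[0, 1[) r by split; [exact: nbhs_singleton|rewrite /= in_itv].
have : {uniform [set r], (fun N r => \sum_(0 <= n < N) zeta n r) @ \oo --> Z}.
  by apply: uniform_subset_cvg cU => x ->.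
rewrite uniform_set1 => c0.
apply/cvg_ex; exists (Z r - zeta 0%N r).
(* A partial sum from 1 is the one from 0 minus its first term only for N >= 1, hence the shift. *)
rewrite -(cvg_shiftS _) /=.
rewrite (_ : (fun N => _) = (fun N => (\sum_(0 <= n < N.+1) zeta n r) - zeta 0%N r)); last first.
  by apply/funext => N; rewrite [in RHS]big_ltn//; ring.
by apply: cvgB; [rewrite (cvg_shiftS (fun N => \sum_(0 <= n < N) zeta n r))|exact: cvg_cst].
Qed.

Lemma nneseries_Phi1 (R : realType) (zeta : nat -> R -> R) (r k : R) : classF zeta -> 0 <= r < 1 ->
  (\sum_(1 <= n <oo) (k * zeta n r)%:E)%E = (k * Phi1 zeta r)%:E.
Proof.
move=> zF r01; have cz := classF_cvg zF r01.
rewrite /Phi1; apply/cvg_lim => //.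
rewrite (_ : (fun n => _) = EFin \o (fun N => k * \sum_(1 <= n < N) zeta n r)); last first.
  by apply/funext => N /=; rewrite sumEFin mulr_sumr.
apply: cvg_EFin; first by near=> n.
by apply: cvgM => //; exact: cvg_cst.
Unshelve. all: by end_near.
Qed.

Lemma norm_psi_coef (R : realType) (a0 : R) (n : nat) : a0 < 1 -> (0 < n)%N ->
  `|psi_coef a0 n| = (2 * (1 - a0))%:C.
Proof.
move=> a01 n0; rewrite /psi_coef gtn_eqF// rmorphN normrN ger0_norm// lecR mulr_ge0//; lra.
Qed.

(** All coefficients past the first have modulus 2 (1 - a0), and the area over pi is 4 (1 - a0)^2
    r^2 / (1 - r^2)^2; the factor 1 - a0^2 cancels the denominator 1 + a0 of [phi]. *)
Lemma bohr_sum_psi (R : realType) (lambda a0 r : R) (zeta : nat -> R -> R) :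
  classF zeta -> 0 <= a0 < 1 -> 0 <= r < 1 ->
  bohr_sum lambda zeta a0 (psi a0) (psi_coef a0) r =
  (a0 ^+ 2 * zeta 0%N r + (1 - a0 ^+ 2) * phi lambda zeta a0 r)%:E.
Proof.
move=> zF /andP[a00 a01] r01; rewrite /bohr_sum.
have -> : (\sum_(1 <= n <oo) (complex.Re `|psi_coef a0 n| * zeta n r)%:E =
           \sum_(1 <= n <oo) (2 * (1 - a0) * zeta n r)%:E)%E.
  rewrite eseries_cond [RHS]eseries_cond; apply: eq_eseriesr => n n1.
  by rewrite norm_psi_coef.
rewrite nneseries_Phi1// image_area_psi// -!EFinM -!EFinD /phi; congr (_%:E).
have p0 : pi != 0 :> R by rewrite gt_eqF// pi_gt0.
have d0 : 1 - r ^+ 2 != 0 by rewrite gt_eqF//; case/andP: r01 => r0 r1; nra.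
have a1 : 1 + a0 != 0 by rewrite gt_eqF//; lra.
by move: pi p0 => p p0; field; rewrite d0 a1.
Qed.

Lemma bohr_sum_le_psi (R : realType) (lambda a0 r : R) (zeta : nat -> R -> R)
    (f : R[i] -> R[i]) (a : nat -> R[i]) :
  0 < lambda -> classF zeta -> a0 < 1 -> 0 <= r < 1 ->
  (forall z, disk 1 z -> complex.Re (f z) < 1) -> has_expansion f a -> a 0%N = a0%:C ->
  (bohr_sum lambda zeta a0 f a r <= bohr_sum lambda zeta a0 (psi a0) (psi_coef a0) r)%E.
Proof.
move=> l0 [z0 _ _] a01 r01 f1 ha a00; apply: leeD.
  rewrite leeD2l// eseries_cond [leRHS]eseries_cond; apply: lee_nneseries => n.
    move=> _ _; rewrite lee_fin mulr_ge0 ?z0//.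
    by rewrite -ler0c RRe_real ?normr_real.
  move=> n1; rewrite lee_fin ler_wpM2r ?z0// -lecR !RRe_real ?normr_real//.
  by rewrite norm_psi_coef//; exact: classP_coef_le f1 ha a00 n1.
apply: lee_wpmul2l; first by rewrite lee_fin ltW.
apply: lee_wpmul2r; first by rewrite lee_fin invr_ge0 pi_ge0.
exact: image_area_le_psi ha a00 _ _.
Qed.

(** The Bohr sum of [psi a0] is a convex combination of zeta_0 and phi with positive weight on phi,
    so it lies on the same side of zeta_0 as phi. This gives the bound up to [rho], equality at the
    root, and failure wherever phi exceeds zeta_0, which is the form given to sharpness. *)
Theorem theorem3 (R : realType) (lambda a0 rho : R) (zeta : nat -> R -> R)
    (lambda_gt0 : 0 < lambda)
    (a0_ge0_lt1 : 0 <= a0 < 1)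
    (zetaF : classF zeta)
    (rho_root : minimal_positive_root lambda zeta a0 rho)
    (zeta_phi : forall r : R, 0 <= r <= rho ->
       phi lambda zeta a0 r <= zeta 0%N r) :
  (forall (f : R[i] -> R[i]) (a : nat -> R[i]),
     classP f -> has_expansion f a -> a 0%N = a0%:C ->
     forall r : R, 0 <= r <= rho ->
       (bohr_sum lambda zeta a0 f a r <= (zeta 0%N r)%:E)%E)
  /\
  (classP (psi a0) /\
   exists b : nat -> R[i],
     [/\ has_expansion (psi a0) b,
         b 0%N = a0%:C,
         bohr_sum lambda zeta a0 (psi a0) b rho = (zeta 0%N rho)%:E &
         forall r : R, 0 <= r < 1 ->
           zeta 0%N r < phi lambda zeta a0 r ->
           ((zeta 0%N r)%:E < bohr_sum lambda zeta a0 (psi a0) b r)%E]).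
Proof.
have [/andP[rho0 rho1] rhoE _] := rho_root.
have /andP[a00 a01] := a0_ge0_lt1.
have a2 : 0 < 1 - a0 ^+ 2 by nra.
split.
  move=> f a [_ f1] ha aE r /andP[r0 rr].
  have r01 : 0 <= r < 1 by rewrite r0 (le_lt_trans rr).
  apply: le_trans (bohr_sum_le_psi lambda_gt0 zetaF a01 r01 f1 ha aE) _.
  rewrite bohr_sum_psi// lee_fin.
  have := zeta_phi r; rewrite r0 rr => /(_ isT) h; nra.
split; first by split; [exact: psi_holomorphic|move=> z; exact: Re_psi_lt1].
exists (psi_coef a0); split => //; first exact: psi_expansion.
  rewrite bohr_sum_psi// ?(ltW rho0)// -rhoE; congr (_%:E); ring.
by move=> r r01 h; rewrite bohr_sum_psi// lte_fin; nra.
Qed.
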